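(* Let $N$ be an $n$-dimensional proper slant submanifold of ${\bf C}^m$. If $\nabla F=0$, then $N$ is contained in a complex linear subspace ${\bf C}^n$ of ${\bf C}^m$ as an austere submanifold.
   Context: Manifolds are smooth and connected; $n$ is the real dimension of $N$. ${\bf C}^m$ has its standard flat Kaehler structure with complex structure $J$; ''complex linear subspace'' is understood up to translation (a complex affine subspace of complex dimension $n$). For $X$ tangent to $N$ write $JX=PX+FX$ with $PX$ tangent and $FX$ normal to $N$. With $\nabla$ the Levi-Civita connection of $N$ and $D$ the normal connection, $(\nabla_XF)Y=D_X(FY)-F(\nabla_XY)$. $N$ is slant if the angle between $JX$ and $T_xN$ is a constant $\theta$ independent of $x\in N$ and nonzero $X\in T_xN$; proper slant if moreover $\theta\neq0,\pi/2$. A submanifold is austere if for each normal vector $\xi$ the set of eigenvalues (with multiplicity) of the Weingarten map $A_\xi$ is invariant under multiplication by $-1$. *)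

(* Defs.v *)
From HB Require Import structures.
From mathcomp Require Import all_boot all_order all_algebra.
From mathcomp Require Import complex.
From mathcomp Require Import all_classical all_reals all_analysis.

Set Implicit Arguments.
Unset Strict Implicit.
Unset Printing Implicit Defensive.

Import Order.TTheory GRing.Theory Num.Theory.
Import numFieldNormedType.Exports.

Local Open Scope classical_set_scope.
Local Open Scope ring_scope.
Local Open Scope complex_scope.

(* U is meant to be open: the values of f outside U play no role then. *)
Fixpoint Ck_on (R : realType) (V W : normedModType R) (k : nat) (U : set V)
    (f : V -> W) : Prop :=
  if k is k'.+1 then
    (forall u, U u -> differentiable f u) /\
    (forall v, Ck_on k' U (fun u => 'D_v f u))
  else forall u, U u -> {for u, continuous f}.

Definition smooth_on (R : realType) (V W : normedModType R) (U : set V)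
    (f : V -> W) : Prop :=
  forall k, Ck_on k U f.

(* A homeomorphism between an open subset chart_dom of M and an open subset
   chart_cod of R^n. Both maps are total; only their restrictions to chart_dom
   and chart_cod matter. *)
Record chart (R : realType) (n : nat) (M : topologicalType) := Chart {
  chart_dom : set M;
  chart_cod : set 'rV[R]_n;
  coord : M -> 'rV[R]_n;
  param : 'rV[R]_n -> M;
  chart_dom_open : open chart_dom;
  chart_cod_open : open chart_cod;
  coord_cod : forall p, chart_dom p -> chart_cod (coord p);
  param_dom : forall u, chart_cod u -> chart_dom (param u);
  coordK : forall p, chart_dom p -> param (coord p) = p;
  paramK : forall u, chart_cod u -> coord (param u) = u;
  coord_continuous : forall p, chart_dom p -> {for p, continuous coord};
  param_continuous : forall u, chart_cod u -> {for u, continuous param}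
}.

(* connected holds of the empty set in the library, hence the separate
   nonemptiness field. *)
Record manifold (R : realType) (n : nat) := Manifold {
  carrier :> topologicalType;
  atlas : set (chart R n carrier);
  manifold_hausdorff : hausdorff_space carrier;
  manifold_second_countable : @second_countable carrier;
  manifold_nonempty : [set: carrier] !=set0;
  manifold_connected : connected [set: carrier];
  atlas_cover : forall p : carrier, exists2 c, atlas c & chart_dom c p;
  atlas_smooth : forall c c', atlas c -> atlas c' ->
    smooth_on (chart_cod c `&` param c @^-1` chart_dom c')
              (coord c' \o param c)
}.

(* C^m is R^m x R^m = 'rV[R]_(m + m); the row (x | y) stands for x + i y. *)
Definition to_complex (R : realType) (m : nat) (w : 'rV[R]_(m + m)) :
    'rV[R[i]]_m :=
  \row_j (lsubmx w 0 j +i* rsubmx w 0 j).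

Definition Jop (R : realType) (m : nat) (w : 'rV[R]_(m + m)) :
    'rV[R]_(m + m) :=
  row_mx (- rsubmx w) (lsubmx w).

Definition dot (R : realType) (k : nat) (v w : 'rV[R]_k) : R :=
  (v *m w^T) 0 0.

(* The library norm on 'rV is the sup norm. *)
Definition enorm (R : realType) (k : nat) (v : 'rV[R]_k) : R :=
  Num.sqrt (dot v v).

(* Components of w along the row space of B and along its orthogonal
   complement. *)
Definition tan_part (R : realType) (n k : nat) (B : 'M[R]_(n, k))
    (w : 'rV[R]_k) : 'rV[R]_k :=
  w *m proj_mx <<B>>%MS (kermx B^T).

Definition nor_part (R : realType) (n k : nat) (B : 'M[R]_(n, k))
    (w : 'rV[R]_k) : 'rV[R]_k :=
  w - tan_part B w.

(* Angle, in [0, pi/2], between a nonzero vector w and the row space of B. *)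
Definition angle (R : realType) (n k : nat) (w : 'rV[R]_k)
    (B : 'M[R]_(n, k)) : R :=
  acos (enorm (tan_part B w) / enorm w).

(* Local theory: phi : R^n -> R^k is a local parametrization of an immersed
   submanifold. The i-th row of 'J phi u is the coordinate vector
   (d/du_i) phi at u, so the tangent space at u is the row space of 'J phi u,
   and a tangent vector field along phi is given by its components
   Y : R^n -> R^n in the coordinate frame. *)

Definition push (R : realType) (n k : nat) (phi : 'rV[R]_n -> 'rV[R]_k)
    (Y : 'rV[R]_n -> 'rV[R]_n) (u : 'rV[R]_n) : 'rV[R]_k :=
  Y u *m 'J phi u.

Definition metric (R : realType) (n k : nat) (phi : 'rV[R]_n -> 'rV[R]_k)
    (u : 'rV[R]_n) : 'M[R]_n :=
  'J phi u *m ('J phi u)^T.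

Definition dmetric (R : realType) (n k : nat) (phi : 'rV[R]_n -> 'rV[R]_k)
    (u : 'rV[R]_n) (i j l : 'I_n) : R :=
  'D_(delta_mx 0 i) (fun u' => metric phi u' j l : R^o) u.

(* Gamma^l_{ij} *)
Definition christoffel (R : realType) (n k : nat)
    (phi : 'rV[R]_n -> 'rV[R]_k) (u : 'rV[R]_n) (i j l : 'I_n) : R :=
  2^-1 * \sum_(s < n) invmx (metric phi u) l s *
    (dmetric phi u i j s + dmetric phi u j i s - dmetric phi u s i j).

(* Components of nabla_X Y at u, where X has the value v at u. *)
Definition levi_civita (R : realType) (n k : nat)
    (phi : 'rV[R]_n -> 'rV[R]_k) (v : 'rV[R]_n) (Y : 'rV[R]_n -> 'rV[R]_n)
    (u : 'rV[R]_n) : 'rV[R]_n :=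
  'D_v Y u +
  \row_l \sum_(i < n) \sum_(j < n) christoffel phi u i j l * v 0 i * Y u 0 j.

(* Gauss formula: h(X, Y) is the difference between the flat derivative of Y
   and nabla_X Y. *)
Definition second_ff (R : realType) (n k : nat)
    (phi : 'rV[R]_n -> 'rV[R]_k) (v : 'rV[R]_n) (Y : 'rV[R]_n -> 'rV[R]_n)
    (u : 'rV[R]_n) : 'rV[R]_k :=
  'D_v (push phi Y) u - push phi (levi_civita phi v Y) u.

(* Matrix of A_xi in the coordinate frame, acting on rows of components: it is
   determined by <A_xi X, Y> = <h(X, Y), xi>. As h is tensorial in Y, the
   coordinate vectors are extended with constant components. *)
Definition weingarten (R : realType) (n k : nat)
    (phi : 'rV[R]_n -> 'rV[R]_k) (u : 'rV[R]_n) (xi : 'rV[R]_k) : 'M[R]_n :=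
  (\matrix_(i, j)
     dot (second_ff phi (delta_mx 0 i) (fun=> delta_mx 0 j) u) xi)
  *m invmx (metric phi u).

Definition normal_connection (R : realType) (n k : nat)
    (phi : 'rV[R]_n -> 'rV[R]_k) (v : 'rV[R]_n) (xi : 'rV[R]_n -> 'rV[R]_k)
    (u : 'rV[R]_n) : 'rV[R]_k :=
  nor_part ('J phi u) ('D_v xi u).

Definition Fop (R : realType) (n m : nat)
    (phi : 'rV[R]_n -> 'rV[R]_(m + m)) (Y : 'rV[R]_n -> 'rV[R]_n)
    (u : 'rV[R]_n) : 'rV[R]_(m + m) :=
  nor_part ('J phi u) (Jop (push phi Y u)).

(* (nabla_X F) Y at u, where X has the value v at u. *)
Definition nablaF (R : realType) (n m : nat)
    (phi : 'rV[R]_n -> 'rV[R]_(m + m)) (v : 'rV[R]_n)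
    (Y : 'rV[R]_n -> 'rV[R]_n) (u : 'rV[R]_n) : 'rV[R]_(m + m) :=
  normal_connection phi v (Fop phi Y) u - Fop phi (levi_civita phi v Y) u.

Definition immersion (R : realType) (n k : nat) (N : manifold R n)
    (f : N -> 'rV[R]_k) : Prop :=
  forall c, atlas c ->
    smooth_on (chart_cod c) (f \o param c) /\
    (forall u, chart_cod c u -> row_free ('J (f \o param c) u)).

Definition slant_with_angle (R : realType) (n m : nat) (N : manifold R n)
    (f : N -> 'rV[R]_(m + m)) (theta : R) : Prop :=
  forall c u (X : 'rV[R]_(m + m)), atlas c -> chart_cod c u ->
    (X <= 'J (f \o param c) u)%MS -> X != 0 ->
    angle (Jop X) ('J (f \o param c) u) = theta.

Definition proper_slant (R : realType) (n m : nat) (N : manifold R n)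
    (f : N -> 'rV[R]_(m + m)) : Prop :=
  exists theta : R,
    [/\ slant_with_angle f theta, theta != 0 & theta != pi / 2].

Definition parallel_F (R : realType) (n m : nat) (N : manifold R n)
    (f : N -> 'rV[R]_(m + m)) : Prop :=
  forall c u v (Y : 'rV[R]_n -> 'rV[R]_n), atlas c -> chart_cod c u ->
    smooth_on (chart_cod c) Y ->
    nablaF (f \o param c) v Y u = 0.

(* V is a complex linear subspace of C^m (the row space of a matrix), of
   complex dimension \rank V. *)
Definition contained_in (R : realType) (n m : nat) (N : manifold R n)
    (f : N -> 'rV[R]_(m + m)) (a : 'rV[R]_(m + m)) (V : 'M[R[i]]_m) : Prop :=
  forall p, (to_complex (f p - a) <= V)%MS.

(* f is austere as a submanifold of a translate of V: the normal vectors are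
   those of f(N) inside that affine subspace. Its Levi-Civita connection being
   the restriction of the flat one, the second fundamental form is that of f.
   A_xi is self-adjoint, so its eigenvalues are the real roots of char_poly,
   with their multiplicities mup. *)
Definition austere_in (R : realType) (n m : nat) (N : manifold R n)
    (f : N -> 'rV[R]_(m + m)) (V : 'M[R[i]]_m) : Prop :=
  forall c u (xi : 'rV[R]_(m + m)), atlas c -> chart_cod c u ->
    (to_complex xi <= V)%MS -> xi *m ('J (f \o param c) u)^T = 0 ->
    forall a : R,
      mup a (char_poly (weingarten (f \o param c) u xi)) =
      mup (- a) (char_poly (weingarten (f \o param c) u xi)).

(* Main.v *)
(* The angle hypothesis says that 0 < |PX| < |X| for X <> 0, so P and 1 + P^2
   are invertible and W = T + JT has complex dimension n. With h the second
   fundamental form and f the normal part of J on normal vectors, nabla F = 0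
   reads f h(X, Y) = h(X, PY). The component K of h orthogonal to W therefore
   satisfies J K(X, Y) = K(X, PY), so K(X, (1 + P^2) Y) = 0 and K = 0. Hence W
   is preserved by differentiation along N: the projection onto W has zero
   derivative, W is constant, and N lies in a translate of it. As f h(X, Y) is
   symmetric, h(X, PY) = h(PX, Y), that is, P A_xi = - A_xi P; since P is
   invertible, A_xi is similar to - A_xi. *)

From HB Require Import structures.
Require Import Defs.
From mathcomp Require Import all_boot all_order all_algebra.
From mathcomp Require Import complex.
From mathcomp Require Import all_classical all_reals all_analysis.
From mathcomp Require Import ring lra.

Set Implicit Arguments.
Unset Strict Implicit.
Unset Printing Implicit Defensive.

Import Order.TTheory GRing.Theory Num.Theory.
Import numFieldNormedType.Exports.

Local Open Scope classical_set_scope.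
Local Open Scope ring_scope.

(** * Orthogonal projections and characteristic polynomials *)

Lemma mulmx_tr_eq0 (R : realFieldType) (p q : nat) (A : 'M[R]_(p, q)) :
  A *m A^T = 0 -> A = 0.
Proof.
move=> AA0; apply/matrixP => i j; rewrite mxE; apply/eqP.
have : (A *m A^T) i i = 0 by rewrite AA0 mxE.
rewrite mxE; under eq_bigr do rewrite mxE -expr2.
move/eqP; rewrite psumr_eq0 => [/allP|k _]; last exact: sqr_ge0.
by move/(_ j (mem_index_enum j)); rewrite /= sqrf_eq0.
Qed.

Lemma gram_unitmx (R : realFieldType) (p q : nat) (B : 'M[R]_(p, q)) :
  row_free B -> B *m B^T \in unitmx.
Proof.
move=> freeB; rewrite -row_free_unit -kermx_eq0; apply/eqP/mulmx_tr_eq0.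
set K := kermx _.
have : (K *m B) *m (K *m B)^T = 0.
  by rewrite trmx_mul mulmxA -(mulmxA K) mulmx_ker mul0mx.
move/mulmx_tr_eq0 => KB0; suff -> : K = 0 by rewrite mul0mx.
by apply: (row_free_inj freeB); rewrite mul0mx.
Qed.

(* Locked, so that rewriting with associativity does not unfold it. *)
HB.lock Definition oproj (R : realFieldType) (p q : nat) (B : 'M[R]_(p, q)) :
    'M[R]_q :=
  B^T *m invmx (B *m B^T) *m B.
Canonical oproj_unlockable := Unlockable oproj.unlock.

Section orthogonal_projection.
Context {R : realFieldType} {p q : nat} (B : 'M[R]_(p, q)).

Local Notation oproj := (oproj B).

Lemma oprojE : oproj = B^T *m invmx (B *m B^T) *m B.
Proof. by rewrite unlock. Qed.

Lemma oproj_tr : oproj^T = oproj.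
Proof. by rewrite oprojE !trmx_mul trmxK trmx_inv trmx_mul trmxK mulmxA. Qed.

Hypothesis freeB : row_free B.
Let unitG := gram_unitmx freeB.

Lemma mulmx_oproj : B *m oproj = B.
Proof. by rewrite oprojE !mulmxA mulmxV// mul1mx. Qed.

Lemma oproj_eqmx : (oproj :=: B)%MS.
Proof.
apply/eqmxP; rewrite {1}oprojE submxMl.
by rewrite -{1}mulmx_oproj submxMl.
Qed.

Lemma oproj_id r (A : 'M[R]_(r, q)) : (A <= B)%MS -> A *m oproj = A.
Proof. by case/submxP => D ->; rewrite -mulmxA mulmx_oproj. Qed.

Lemma oproj_sub r (A : 'M[R]_(r, q)) : (A <= B)%MS = (A *m (1%:M - oproj) == 0).
Proof.
rewrite mulmxBr mulmx1 subr_eq0 eq_sym.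
by apply/idP/eqP => [/oproj_id //|<-]; rewrite -oproj_eqmx submxMl.
Qed.

Lemma oproj_idem : oproj *m oproj = oproj.
Proof. by rewrite oproj_id// oproj_eqmx. Qed.

Lemma oproj_compl_ortho : (1%:M - oproj) *m B^T = 0.
Proof.
by rewrite mulmxBl mul1mx oprojE -(mulmxA _ B) mulmxKV ?subrr.
Qed.

(** This replaces the projection along a chosen complement by a closed formula in [B], which can be
    differentiated when [B] varies. *)
Lemma tan_part_oproj (w : 'rV[R]_q) :
  w *m proj_mx <<B>>%MS (kermx B^T) = w *m oproj.
Proof.
have dir : (<<B>> :&: kermx B^T = 0)%MS.
  apply/eqP/rowV0P => v; rewrite sub_capmx genmxE => /andP[/submxP[D ->]].
  move/sub_kermxP; rewrite -mulmxA => /(congr1 (mulmx^~ (invmx (B *m B^T)))).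
  by rewrite mulmxK// mul0mx => ->; rewrite mul0mx.
have dec : w = w *m oproj + w *m (1%:M - oproj).
  by rewrite mulmxBr mulmx1 addrC subrK.
rewrite {1}dec mulmxDl proj_mx_id// ?proj_mx_0 ?addr0//.
  by apply/sub_kermxP; rewrite -mulmxA oproj_compl_ortho mulmx0.
by rewrite genmxE -oproj_eqmx submxMl.
Qed.

End orthogonal_projection.

(** Equal row spaces give P_A P_B = P_A and P_B P_A = P_B; transposing the second, by symmetry of
    both projections, yields P_A P_B = P_B. *)
Lemma oproj_eq (R : realFieldType) (p r q : nat) (A : 'M[R]_(p, q))
    (B : 'M[R]_(r, q)) :
  row_free A -> row_free B -> (A :=: B)%MS -> oproj A = oproj B.
Proof.
move=> fA fB eAB.
have e1 : oproj A *m oproj B = oproj A.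
  by rewrite (oproj_id fB)// oproj_eqmx// eAB.
have e2 : oproj B *m oproj A = oproj B.
  by rewrite (oproj_id fA)// oproj_eqmx// eAB.
by rewrite -e1 -(oproj_tr A) -(oproj_tr B) -trmx_mul e2 oproj_tr.
Qed.

Lemma row_free_submx_eq (F : fieldType) (p q : nat) (A B : 'M[F]_(p, q)) :
  row_free A -> row_free B -> (A <= B)%MS -> (A :=: B)%MS.
Proof.
move=> /eqP fA /eqP fB AB; apply/eqmxP.
by rewrite -(mxrank_leqif_eq AB) fA fB.
Qed.

Lemma char_poly_opp (R : comUnitRingType) (n : nat) (A : 'M[R]_n) :
  char_poly A \Po - 'X = (-1) ^+ n *: char_poly (- A).
Proof.
rewrite /char_poly -[(-1) ^+ n *: _]mul_polyC rmorphXn rmorphN1 -detZ.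
rewrite -[LHS](det_map_mx (comp_poly (- 'X))); congr (\det _).
apply/matrixP => i j; rewrite !mxE mulN1r !rmorphB/= comp_polyC rmorphMn/=.
by rewrite comp_polyX rmorphN/= opprK mulNrn opprD.
Qed.

(** Anticommutation says (X + A) P = P (X - A) over polynomials; take determinants and cancel det
    P. *)
Lemma char_poly_anticomm (F : fieldType) (n : nat) (P A : 'M[F]_n) :
  P \in unitmx -> P *m A = - (A *m P) -> char_poly (- A) = char_poly A.
Proof.
move=> uP PA; pose Q := map_mx polyC P.
have uQ : \det Q != 0.
  by rewrite det_map_mx polyC_eq0 -unitfE.
apply: (mulIf uQ); rewrite /char_poly -det_mulmx mulrC -det_mulmx.
congr (\det _); rewrite /char_poly_mx mulmxBl mulmxBr.
rewrite scalar_mxC -!map_mxM/= PA mulNmx; congr (_ - _).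
Qed.

(** Substituting -X turns a factor X - b into -(X + b), so the multiplicity at -b is at least that
    at b; apply this to b = a and b = -a. *)
Lemma mup_oppX (F : fieldType) (p : {poly F}) (c a : F) :
  p != 0 -> c != 0 -> p \Po - 'X = c *: p -> mup a p = mup (- a) p.
Proof.
move=> p0 c0 pc; suff le b : (mup b p <= mup (- b) p)%N.
  by apply/eqP; rewrite eqn_leq le -{2}[a]opprK le.
rewrite mup_geq//; have : ('X - b%:P) ^+ mup b p %| p by rewrite -mup_geq.
move=> /(dvdp_comp_poly (- 'X)); rewrite pc dvdpZr// rmorphXn/= rmorphB/=.
rewrite comp_polyX comp_polyC -opprD exprNn -signr_odd mulr_sign.
by case: ifP => _; rewrite ?dvdpNl rmorphN opprK.
Qed.

(** The source of austerity: P will be the tangential part of J, and A a Weingarten map. *)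
Lemma anticomm_mup (F : fieldType) (n : nat) (P A : 'M[F]_n) (a : F) :
  P \in unitmx -> P *m A = - (A *m P) ->
  mup a (char_poly A) = mup (- a) (char_poly A).
Proof.
move=> uP PA; apply: (@mup_oppX _ _ ((-1) ^+ n)).
- exact/monic_neq0/char_poly_monic.
- by rewrite expf_neq0// oppr_eq0 oner_eq0.
- by rewrite char_poly_opp (char_poly_anticomm uP PA).
Qed.
(** * The complex structure and the spaces T + JT *)

Local Open Scope complex_scope.

HB.lock Definition Jmx (R : realType) (m : nat) : 'M[R]_(m + m) :=
  block_mx 0 1%:M (- 1%:M) 0.
Canonical Jmx_unlockable := Unlockable Jmx.unlock.
Arguments Jmx {R m}.

Section complex_structure.
Context {R : realType} {m : nat}.

Local Notation Jmx := (@Jmx R m).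

Let JmxE : Jmx = block_mx 0 1%:M (- 1%:M) 0.
Proof. by rewrite unlock. Qed.

Lemma Jop_mulmx (w : 'rV[R]_(m + m)) : Jop w = w *m Jmx.
Proof.
rewrite JmxE -[w in RHS]hsubmxK mul_row_block !mulmx0 add0r addr0 mulmx1.
by rewrite mulmxN mulmx1.
Qed.

Lemma Jmx_sqr : Jmx *m Jmx = - 1%:M.
Proof.
rewrite JmxE mulmx_block !mulmx0 !mul0mx !mulmxN !mulNmx !mulmx1 !add0r !addr0.
by rewrite scalar_mx_block opp_block_mx !oppr0.
Qed.

Lemma Jmx_tr : Jmx^T = - Jmx.
Proof.
by rewrite JmxE tr_block_mx !trmx0 linearN/= !trmx1 opp_block_mx !oppr0 opprK.
Qed.

Definition complex_mx p (A : 'M[R]_(p, m + m)) : 'M[R[i]]_(p, m) :=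
  map_mx (real_complex R) (lsubmx A) + 'i *: map_mx (real_complex R) (rsubmx A).

Lemma to_complexE (w : 'rV[R]_(m + m)) : to_complex w = complex_mx w.
Proof.
apply/matrixP => i j; rewrite !mxE ord1 [LHS]complexE.
by [].
Qed.

Lemma complex_mx_mul p q (X : 'M[R]_(p, q)) (A : 'M[R]_(q, m + m)) :
  complex_mx (X *m A) = map_mx (real_complex R) X *m complex_mx A.
Proof.
rewrite /complex_mx -[A in LHS]hsubmxK mul_mx_row row_mxKl row_mxKr.
by rewrite !map_mxM mulmxDr scalemxAr.
Qed.

Lemma complex_mxD p (A B : 'M[R]_(p, m + m)) :
  complex_mx (A + B) = complex_mx A + complex_mx B.
Proof. by rewrite /complex_mx !linearD/= !map_mxD scalerDr addrACA. Qed.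

Lemma complex_mxJ p (A : 'M[R]_(p, m + m)) :
  complex_mx (A *m Jmx) = 'i *: complex_mx A.
Proof.
rewrite /complex_mx JmxE -[A in LHS]hsubmxK mul_row_block !mulmx0 add0r addr0.
rewrite row_mxKl row_mxKr mulmx1 mulmxN mulmx1 scalerDr scalerA -expr2.
by rewrite sqr_i scaleN1r map_mxN addrC.
Qed.

Lemma complex_mx_inj p : injective (@complex_mx p).
Proof.
move=> A B AB; rewrite -(hsubmxK A) -(hsubmxK B).
have e i j := congr1 (fun M : 'M[R[i]]_(p, m) => M i j) AB.
have reE (x y : R) : x%:C + 'i * y%:C = x +i* y.
  by rewrite [RHS]complexE.
by congr row_mx; apply/matrixP => i j; move: (e i j); rewrite !mxE !reE => -[].
Qed.

Lemma complex_mx_decomp p q (Z : 'M[R[i]]_(p, q)) :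
  exists X Y : 'M[R]_(p, q),
    Z = map_mx (real_complex R) X + 'i *: map_mx (real_complex R) Y.
Proof.
exists (map_mx (@complex.Re R) Z), (map_mx (@complex.Im R) Z).
by apply/matrixP => i j; rewrite !mxE [LHS]complexE.
Qed.

(** Complex combinations of the rows of B are real combinations of the rows of B and BJ. Complex
    inclusions and ranks thus reduce to real ones. *)
Lemma mul_complex_mx p q (X Y : 'M[R]_(p, q)) (B : 'M[R]_(q, m + m)) :
  (map_mx (real_complex R) X + 'i *: map_mx (real_complex R) Y) *m complex_mx B
  = complex_mx (row_mx X Y *m col_mx B (B *m Jmx)).
Proof.
rewrite mul_row_col complex_mxD complex_mx_mul mulmxA complex_mxJ.
by rewrite complex_mx_mul mulmxDl scalemxAl.
Qed.

Lemma complex_mx_sub p n (A : 'M[R]_(p, m + m)) (B : 'M[R]_(n, m + m)) :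
  (complex_mx A <= complex_mx B)%MS = (A <= col_mx B (B *m Jmx))%MS.
Proof.
apply/idP/idP => [|] /submxP[Z].
  have [X [Y ->]] := complex_mx_decomp Z.
  by rewrite mul_complex_mx => /complex_mx_inj ->; rewrite submxMl.
by rewrite -[Z]hsubmxK => ->; rewrite -mul_complex_mx submxMl.
Qed.

Lemma complex_mx_free n (B : 'M[R]_(n, m + m)) :
  row_free (col_mx B (B *m Jmx)) -> row_free (complex_mx B).
Proof.
move=> fE; rewrite -kermx_eq0; apply/eqP.
have [X [Y K]] := complex_mx_decomp (kermx (complex_mx B)).
have := mulmx_ker (complex_mx B); rewrite K mul_complex_mx => /eqP.
have -> : 0 = complex_mx (0 : 'M[R]_(n, m + m)).
  by rewrite /complex_mx !linear0 !map_mx0 scaler0 addr0.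
move=> /eqP/complex_mx_inj; rewrite -(mul0mx _ (col_mx B (B *m Jmx))).
move=> /(row_free_inj fE); rewrite -row_mx0 => /eq_row_mx[-> ->].
by rewrite map_mx0 scaler0 addr0.
Qed.

End complex_structure.

(* Matrix of P in the frame B of the tangent space, acting on rows of
   components. *)
HB.lock Definition Pmx (R : realType) (n m : nat) (B : 'M[R]_(n, m + m)) :
    'M[R]_n :=
  B *m Jmx *m B^T *m invmx (B *m B^T).
Canonical Pmx_unlockable := Unlockable Pmx.unlock.

Section tangent_space.
Context {R : realType} {n m : nat} (B : 'M[R]_(n, m + m)).
Hypothesis freeB : row_free B.
Local Notation J := (@Jmx R m).
Local Notation Pi := (oproj B).

Local Notation Pmx := (Pmx B).

Definition complex_frame : 'M[R]_(n + n, m + m) := col_mx B (B *m J).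
Local Notation E := complex_frame.

Lemma PmxE : Pmx *m B = B *m J *m Pi.
Proof. by rewrite unlock oprojE !mulmxA. Qed.

Lemma frame_subl : (B <= E)%MS.
Proof. by rewrite /complex_frame -addsmxE addsmxSl. Qed.

Lemma frame_subr : (B *m J <= E)%MS.
Proof. by rewrite /complex_frame -addsmxE addsmxSr. Qed.

Lemma frameJ : (E *m J <= E)%MS.
Proof.
rewrite {1}/complex_frame mul_col_mx -mulmxA Jmx_sqr mulmxN mulmx1.
by rewrite col_mx_sub frame_subr -(scaleN1r B) scalemx_sub// frame_subl.
Qed.

(** With X = vB tangent, this and the next definition say that P, respectively F, has no kernel.
    These are the two consequences of proper slantness used below. *)
Definition nowhere_totally_real :=
  forall v : 'rV_n, v *m B *m J *m Pi = 0 -> v = 0.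
Definition nowhere_complex :=
  forall v : 'rV_n, v *m B *m J *m (1%:M - Pi) = 0 -> v = 0.

Hypothesis tanJ : nowhere_totally_real.
Hypothesis norJ : nowhere_complex.

Lemma Pmx_unit : Pmx \in unitmx.
Proof.
rewrite -row_free_unit -kermx_eq0; apply/rowV0P => v /sub_kermxP vP.
by apply: tanJ; rewrite -mulmxA -mulmxA (mulmxA B) -PmxE mulmxA vP mul0mx.
Qed.

(** The normal part of a relation X + JY = 0 is FY = 0, so Y = 0 and then X = 0. *)
Lemma frame_free : row_free E.
Proof.
rewrite -kermx_eq0; apply/rowV0P => w /sub_kermxP.
rewrite -[w]hsubmxK mul_row_col => vE.
have Y0 : rsubmx w = 0.
  apply: norJ; have := congr1 (mulmx^~ (1%:M - Pi)) vE.
  rewrite mul0mx mulmxDl -(mulmxA (lsubmx w)) (mulmxBr B) mulmx1 mulmx_oproj//.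
  by rewrite subrr mulmx0 add0r mulmxA.
move: vE; rewrite Y0 mul0mx addr0 => /eqP; rewrite mulmx_free_eq0//.
by move=> /eqP ->; rewrite row_mx0.
Qed.

(** For tangent X, skewness of J gives |FX|^2 = <X + P^2 X, X>. A kernel vector therefore has FX =
    0, hence is zero. *)
Lemma one_plus_Pmx_sqr_unit : 1%:M + Pmx *m Pmx \in unitmx.
Proof.
rewrite -row_free_unit -kermx_eq0; apply/rowV0P => v /sub_kermxP vP.
set x := v *m B.
have xPi : x *m Pi = x by rewrite /x -mulmxA mulmx_oproj.
have xx : x + x *m J *m Pi *m J *m Pi = 0.
  have xP (y : 'rV_n) : y *m B *m J *m Pi = y *m Pmx *m B.
    by rewrite -(mulmxA y Pmx) PmxE !mulmxA.
  rewrite /x !xP -mulmxDl -[X in X + _]mulmx1 -(mulmxA v Pmx) -mulmxDr vP.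
  by rewrite mul0mx.
apply: norJ; apply: mulmx_tr_eq0.
have QT : (1%:M - Pi)^T = 1%:M - Pi by rewrite linearB/= trmx1 oproj_tr.
have QQ : (1%:M - Pi) *m (1%:M - Pi) = 1%:M - Pi.
  by rewrite mulmxBl mul1mx mulmxBr mulmx1 oproj_idem// subrr subr0.
rewrite trmx_mul QT mulmxA -(mulmxA _ (1%:M - Pi) (1%:M - Pi)) QQ trmx_mul.
rewrite Jmx_tr.
rewrite mulmxA mulmxN mulNmx mulmxBr mulmx1 !mulmxBl -/x -(mulmxA x) Jmx_sqr.
rewrite mulmxN mulmx1 mulNmx opprB opprK.
have -> : x^T = Pi *m x^T by rewrite -{1}xPi trmx_mul oproj_tr.
by rewrite !mulmxA xPi addrC -mulmxDl xx mul0mx.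
Qed.

(** Invariance of the row space under J reads W J W = W J; transposing, with W symmetric and J skew,
    gives W J W = J W. *)
Lemma oproj_frameJ : oproj E *m J = J *m oproj E.
Proof.
set W := oproj E.
have h : W *m J *m W = W *m J.
  apply: (oproj_id frame_free); apply: submx_trans frameJ.
  by apply: submxMr; rewrite (oproj_eqmx frame_free).
rewrite -h; have := congr1 trmx h.
rewrite !trmx_mul Jmx_tr oproj_tr !mulNmx !mulmxN mulmxA.
by move=> /oppr_inj.
Qed.

(* The component K of D orthogonal to T + JT satisfies KJ = PK, hence
   (1 + P^2) K = 0. *)
Lemma parallel_sub_frame (D : 'M[R]_(n, m + m)) (C : 'M[R]_n) :
  (D *m J - Pmx *m D - C *m B *m J) *m (1%:M - Pi) = 0 ->
  (D <= E)%MS.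
Proof.
set W := oproj E => h; rewrite (oproj_sub frame_free).
set K := D *m _.
have PiW : (1%:M - Pi) *m (1%:M - W) = 1%:M - W.
  rewrite mulmxBl mul1mx mulmxBr mulmx1 (oproj_id frame_free) ?subrr ?subr0//.
  by rewrite (oproj_eqmx freeB) frame_subl.
have WJ : J *m (1%:M - W) = (1%:M - W) *m J.
  by rewrite mulmxBr mulmxBl mulmx1 mul1mx oproj_frameJ.
(* Project the hypothesis further, onto the complement of T + JT: the term in [C] has its rows in JT
   and disappears. *)
have KJ : K *m J = Pmx *m K.
  have := congr1 (mulmx^~ (1%:M - W)) h; rewrite mul0mx.
  rewrite -(mulmxA _ (1%:M - Pi) (1%:M - W)) PiW !(mulmxBl _ _ (1%:M - W)).
  have -> : C *m B *m J *m (1%:M - W) = 0.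
    apply/eqP; rewrite -(oproj_sub frame_free) -mulmxA.
    exact: submx_trans (submxMl _ _) frame_subr.
  rewrite subr0 -(mulmxA D) WJ (mulmxA D) -(mulmxA Pmx) => /eqP.
  by rewrite subr_eq0 => /eqP.
have : (1%:M + Pmx *m Pmx) *m K = 0.
  rewrite mulmxDl mul1mx -mulmxA -KJ mulmxA -KJ -mulmxA Jmx_sqr mulmxN mulmx1.
  by rewrite subrr.
move=> /(congr1 (mulmx (invmx (1%:M + Pmx *m Pmx)))).
by rewrite mulKmx ?one_plus_Pmx_sqr_unit// mulmx0 => ->.
Qed.

(** [S] stands for the matrix of <h(X_i, X_j), xi>, and the second hypothesis for h(X, PY) = h(PX,
    Y). With G the Gram matrix and K = B J B^T skew, P = K G^-1 and P^T = - G^-1 K, so P S G^-1 = S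
    P^T G^-1 = - S G^-1 P. *)
Lemma Pmx_anticomm (S : 'M[R]_n) : S^T = S -> (S *m Pmx^T)^T = S *m Pmx^T ->
  Pmx *m (S *m invmx (B *m B^T)) = - (S *m invmx (B *m B^T) *m Pmx).
Proof.
move=> ST; rewrite trmx_mul trmxK ST mulmxA => ->.
rewrite unlock !trmx_mul trmx_inv !trmx_mul trmxK Jmx_tr !mulmxA.
by rewrite !mulmxN !mulNmx.
Qed.

End tangent_space.

(** * Derivatives of matrix-valued maps *)

Section matrix_derivative.
Context {R : realType} {V : normedModType R}.
Implicit Types (t v : V).

Lemma is_derive_mxP p q (M : V -> 'M[R]_(p, q)) t v (dM : 'M[R]_(p, q)) :
  is_derive t v M dM <->
  forall i j, is_derive t v (fun x => M x i j : R) (dM i j).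
Proof.
split=> [[dM1 dM2] i j|h].
  split; first by move/derivable_mxP : dM1; apply.
  by rewrite -dM2 derive_mx// mxE.
have d : derivable M t v.
  by apply/derivable_mxP => i j; have [] := h i j.
split=> //; rewrite derive_mx//; apply/matrixP => i j; rewrite mxE.
by have [] := h i j.
Qed.

Lemma is_derive_sum_seq (I : Type) (r : seq I) (f : I -> V -> R) (df : I -> R)
    t v :
  (forall i, is_derive t v (f i) (df i)) ->
  is_derive t v (fun x => \sum_(i <- r) f i x) (\sum_(i <- r) df i).
Proof.
move=> fd; elim: r => [|i r IH].
  under eq_fun do rewrite big_nil.
  by rewrite big_nil; exact: is_derive_cst.
under eq_fun do rewrite big_cons.
by rewrite big_cons; exact: is_deriveD.
Qed.

Lemma derivable_sum_seq (I : Type) (r : seq I) (f : I -> V -> R) t v :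
  (forall i, derivable (f i) t v) ->
  derivable (fun x => \sum_(i <- r) f i x) t v.
Proof.
by move=> fd; have [] := is_derive_sum_seq r (fun i => derivableP (fd i)).
Qed.

Lemma derivable_prod_seq (I : Type) (r : seq I) (f : I -> V -> R) t v :
  (forall i, derivable (f i) t v) ->
  derivable (fun x => \prod_(i <- r) f i x) t v.
Proof.
move=> fd; elim: r => [|i r IH].
  by under eq_fun do rewrite big_nil; exact: derivable_cst.
by under eq_fun do rewrite big_cons; exact: derivableM.
Qed.

Lemma is_derive_mulmx p q r (A : V -> 'M[R]_(p, q)) (B : V -> 'M[R]_(q, r))
    t v dA dB :
  is_derive t v A dA -> is_derive t v B dB ->
  is_derive t v (fun x => A x *m B x) (dA *m B t + A t *m dB).
Proof.
move=> /is_derive_mxP hA /is_derive_mxP hB; apply/is_derive_mxP => i j.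
under eq_fun do rewrite mxE.
rewrite !mxE -big_split/=; apply: is_derive_sum_seq => k.
rewrite addrC [dA i k * _]mulrC.
exact: (is_deriveM (hA i k) (hB k j)).
Qed.

Lemma is_derive_mulmxl p q r (A : 'M[R]_(p, q)) (B : V -> 'M[R]_(q, r)) t v dB :
  is_derive t v B dB -> is_derive t v (fun x => A *m B x) (A *m dB).
Proof.
move=> hB; have := is_derive_mulmx (is_derive_cst A t v) hB.
by rewrite mul0mx add0r.
Qed.

Lemma is_derive_mulmxr p q r (A : V -> 'M[R]_(p, q)) (B : 'M[R]_(q, r)) t v dA :
  is_derive t v A dA -> is_derive t v (fun x => A x *m B) (dA *m B).
Proof.
move=> hA; have := is_derive_mulmx hA (is_derive_cst B t v).
by rewrite mulmx0 addr0.
Qed.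

Lemma is_derive_trmx p q (A : V -> 'M[R]_(p, q)) t v dA :
  is_derive t v A dA -> is_derive t v (fun x => (A x)^T) dA^T.
Proof.
move=> /is_derive_mxP hA; apply/is_derive_mxP => i j.
by under eq_fun do rewrite mxE; rewrite mxE.
Qed.

Lemma is_derive_col_mx p1 p2 q (A : V -> 'M[R]_(p1, q))
    (B : V -> 'M[R]_(p2, q)) t v dA dB :
  is_derive t v A dA -> is_derive t v B dB ->
  is_derive t v (fun x => col_mx (A x) (B x)) (col_mx dA dB).
Proof.
move=> /is_derive_mxP hA /is_derive_mxP hB; apply/is_derive_mxP => i j.
case: (split_ordP i) => k ->.
  by under eq_fun do rewrite col_mxEu; rewrite col_mxEu.
by under eq_fun do rewrite col_mxEd; rewrite col_mxEd.
Qed.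

Lemma derivable_det p (A : V -> 'M[R]_p) t v :
  derivable A t v -> derivable (fun x => \det (A x)) t v.
Proof.
move=> /derivable_mxP dA; rewrite /determinant.
apply: derivable_sum_seq => s; apply: derivableM; first exact: derivable_cst.
exact: derivable_prod_seq.
Qed.

Lemma derivable_adj p (A : V -> 'M[R]_p) t v :
  derivable A t v -> derivable (fun x => \adj (A x)) t v.
Proof.
move=> dA; apply/derivable_mxP => i j.
under eq_fun do rewrite mxE.
apply: derivableM; first exact: derivable_cst.
apply: derivable_det; apply/derivable_mxP => k l.
by under eq_fun do rewrite !mxE; move/derivable_mxP : dA; apply.
Qed.

(** By Cramer's rule the inverse is a rational function of the entries. On a singular matrix [invmx]
    is the identity function, hence the assumption on a whole neighborhood. *)
Lemma derivable_invmx p (A : V -> 'M[R]_p) t v :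
  (\near t, A t \in unitmx) -> derivable A t v ->
  derivable (fun x => invmx (A x)) t v.
Proof.
move=> uA dA.
apply: (@near_eq_derivable _ _ _ (fun x => (\det (A x))^-1 *: \adj (A x))).
  by near=> x; rewrite /invmx (near uA x).
apply/derivable_mxP => i j; under eq_fun do rewrite mxE.
apply: derivableM.
  apply: derivableV; last exact: derivable_det.
  by rewrite -unitfE -unitmxE; exact: nbhs_singleton uA.
by have /derivable_mxP := derivable_adj dA; apply.
Unshelve. all: by end_near. Qed.

(** This factor is common to [oproj] and [Pmx]. *)
Lemma derivable_tr_gram_inv p q (E : V -> 'M[R]_(p, q)) t v :
  (\near t, row_free (E t)) -> derivable E t v ->
  derivable (fun x => (E x)^T *m invmx (E x *m (E x)^T)) t v.
Proof.
move=> fE /derivableP dE.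
have dET := is_derive_trmx dE.
have dG : derivable (fun x => E x *m (E x)^T) t v.
  by have [] := is_derive_mulmx dE dET.
have /derivableP dI : derivable (fun x => invmx (E x *m (E x)^T)) t v.
  apply: derivable_invmx => //.
  by near=> x; apply: gram_unitmx; exact: (near fE x).
by have [] := is_derive_mulmx dET dI.
Unshelve. all: by end_near. Qed.

(* Differentiating W W = W, with W' W = W' = W W' as the rows of W' lie in
   the row space, gives W' = 2 W'. *)
Lemma is_derive_oproj0 p q (E : V -> 'M[R]_(p, q)) t v dE :
  (\near t, row_free (E t)) -> is_derive t v E dE -> (dE <= E t)%MS ->
  is_derive t v (fun x => oproj (E x)) 0.
Proof.
move=> fE hE dEE.
have fEt : row_free (E t) := nbhs_singleton fE.
have /derivableP dC : derivable
    (fun x => (E x)^T *m invmx (E x *m (E x)^T)) t v.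
  by apply: derivable_tr_gram_inv => //; case: hE.
have := is_derive_mulmx dC hE.
set D := _ + _ => hW.
have {}hW : is_derive t v (fun x => oproj (E x)) D.
  by under eq_fun do rewrite oprojE.
have DE : (D <= E t)%MS.
  by rewrite addmx_sub ?submxMl// (submx_trans (submxMl _ _)).
have DT : D^T = D.
  have [_ <-] := is_derive_trmx hW; have [_ <-] := hW.
  by under eq_fun do rewrite oproj_tr.
have DW : D *m oproj (E t) = D by exact: oproj_id.
have WD : oproj (E t) *m D = D.
  by have := congr1 trmx DW; rewrite trmx_mul oproj_tr DT.
have hWW : is_derive t v (fun x => oproj (E x)) (D + D).
  have := is_derive_mulmx hW hW; rewrite DW WD.
  apply: near_eq_is_derive.
  by near=> x; rewrite oproj_idem//; exact: (near fE x).
have DD : D + D = D by have [_ <-] := hWW; case: hW.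
by move: DD => /eqP; rewrite -subr_eq0 addrK => /eqP <-.
Unshelve. all: by end_near. Qed.

End matrix_derivative.

(** * Mean value theorem and symmetry of second derivatives *)

Section mean_value.
Context {R : realType} {V : normedModType R}.
Implicit Types (u v w x : V) (f : V -> R).

Lemma is_derive_line f x v (a : R) (d : R) :
  is_derive (x + a *: v) v f d -> is_derive a 1 (fun s => f (x + s *: v)) d.
Proof.
have e :
  (fun h : R => h^-1 *:
    (((fun s => f (x + s *: v)) \o shift a) (h *: 1) - f (x + a *: v))) =
  (fun h : R => h^-1 *: ((f \o shift (x + a *: v)) (h *: v) - f (x + a *: v))).
  apply/funext => h /=; congr (_ *: (f _ - _)).
  by rewrite [h *: 1]mulr1 scalerDl addrCA addrA addrAC -addrA.
by move=> [d1 d2]; split; rewrite ?/derivable ?/derive e.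
Qed.

Lemma is_derive_shift f x v w d :
  is_derive (x + w) v f d -> is_derive x v (fun y => f (y + w)) d.
Proof.
have e : (fun h : R => h^-1 *: (((fun y => f (y + w)) \o shift x) (h *: v) -
    f (x + w))) =
  (fun h : R => h^-1 *: ((f \o shift (x + w)) (h *: v) - f (x + w))).
  by apply/funext => h /=; rewrite addrA.
by move=> [d1 d2]; split; rewrite ?/derivable ?/derive e.
Qed.

Lemma MVT_line f (df : V -> R) x v (s : R) : 0 < s ->
  (forall a, 0 <= a <= s -> is_derive (x + a *: v) v f (df (x + a *: v))) ->
  exists2 a, 0 <= a <= s & f (x + s *: v) - f x = df (x + a *: v) * s.
Proof.
move=> s0 h.
have hd a : 0 <= a <= s ->
    is_derive a 1 (fun r => f (x + r *: v)) (df (x + a *: v)).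
  by move=> /h; exact: is_derive_line.
have [a|a|a] := @MVT _ (fun r => f (x + r *: v))
  (fun a => df (x + a *: v)) 0 s s0.
- by rewrite in_itv/= => /andP[a0 as_]; apply: hd; rewrite !ltW.
- by apply: derivable_within_continuous => b; rewrite in_itv/= => /hd [].
- rewrite in_itv/= scale0r addr0 subr0 => /andP[a0 as_] ?.
  by exists a => //; rewrite !ltW.
Qed.

(** Two mean value theorems: along v for the difference f(y + s w) - f(y), then along w for [fv]. *)
Lemma second_increment f (fv fvw : V -> R) u v w (s : R) : 0 < s ->
  (forall a b, 0 <= a <= s -> 0 <= b <= s ->
    is_derive (u + a *: v + b *: w) v f (fv (u + a *: v + b *: w)) /\
    is_derive (u + a *: v + b *: w) w fv (fvw (u + a *: v + b *: w))) ->
  exists a b, [/\ 0 <= a <= s, 0 <= b <= s &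
    f (u + s *: v + s *: w) - f (u + s *: v) - f (u + s *: w) + f u =
    fvw (u + a *: v + b *: w) * s * s].
Proof.
move=> s0 h.
have ss : 0 <= s <= s by rewrite lexx ltW.
have s00 : 0 <= (0 : R) <= s by rewrite lexx ltW.
have [|a as_ ha] := @MVT_line (fun y => f (y + s *: w) - f y)
  (fun y => fv (y + s *: w) - fv y) u v s s0.
  move=> a as_; apply: is_deriveB.
    by apply: is_derive_shift; exact: (h a s as_ ss).1.
  by have [+ _] := h a 0 as_ s00; rewrite scale0r addr0.
have [b bs hb] := @MVT_line fv fvw (u + a *: v) w s s0
  (fun b bs => (h a b as_ bs).2).
exists a, b; split => //.
by rewrite -hb -ha /=; ring.
Qed.

(** The second difference over a small parallelogram is symmetric in v and w. It equals s^2 times a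
    value of [fvw] and also s^2 times a value of [fwv], and both are close to their values at u. *)
Lemma derive_comm f (fv fw fvw fwv : V -> R) u v w (U : set V) :
  nbhs u U ->
  (forall x, U x -> is_derive x v f (fv x)) ->
  (forall x, U x -> is_derive x w f (fw x)) ->
  (forall x, U x -> is_derive x w fv (fvw x)) ->
  (forall x, U x -> is_derive x v fw (fwv x)) ->
  {for u, continuous fvw} -> {for u, continuous fwv} -> fvw u = fwv u.
Proof.
move: v w fv fw fvw fwv.
suff le v w fv fw fvw fwv : nbhs u U ->
  (forall x, U x -> is_derive x v f (fv x)) ->
  (forall x, U x -> is_derive x w f (fw x)) ->
  (forall x, U x -> is_derive x w fv (fvw x)) ->
  (forall x, U x -> is_derive x v fw (fwv x)) ->
  {for u, continuous fvw} -> {for u, continuous fwv} -> fvw u <= fwv u.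
  move=> v w fv fw fvw fwv nU hv hw hvw hwv cvw cwv.
  by apply/eqP; rewrite eq_le (le v w fv fw)// (le w v fw fv).
move=> nU hv hw hvw hwv cvw cwv; rewrite leNgt; apply/negP => lt.
(* By continuity the midpoint still separates the two functions near u. *)
pose c := (fwv u + fvw u) / 2.
have c1 : fwv u < c by rewrite /c; lra.
have c2 : c < fvw u by rewrite /c; lra.
have : \forall x \near u, [/\ U x, fwv x < c & c < fvw x].
  near=> x; split; near: x => //.
  - exact: (cvgr_lt _ cwv).
  - exact: (cvgr_gt _ cvw).
move=> /nbhs_ballP[e /= e0 he].
(* This side length keeps the parallelogram inside the ball; the summand 1 makes the denominator
   positive and the bound strict. *)
pose s := e / (1 + `|v| + `|w|).
have N0 : 0 < 1 + `|v| + `|w| by rewrite -addrA ltr_pwDl// addr_ge0.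
have s0 : 0 < s by rewrite divr_gt0.
have hs a b : 0 <= a <= s -> 0 <= b <= s ->
    [/\ U (u + a *: v + b *: w), fwv (u + a *: v + b *: w) < c &
        c < fvw (u + a *: v + b *: w)].
  move=> /andP[a0 as_] /andP[b0 bs]; apply: he.
  rewrite -ball_normE /ball_/= -addrA opprD addNKr normrN.
  apply: le_lt_trans (ler_normD _ _) _; rewrite !normrZ !ger0_norm//.
  apply: (@le_lt_trans _ _ (s * (`|v| + `|w|))).
    by rewrite mulrDr lerD// ler_wpM2r.
  by rewrite /s mulrAC ltr_pdivrMr// ltr_pM2l// -addrA ltrDr.
have [a [b [ha hb e1]]] := @second_increment f fv fvw u v w s s0
  (fun a b ha hb =>
    let: And3 hU _ _ := hs a b ha hb in conj (hv _ hU) (hvw _ hU)).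
have hs' a' b' : 0 <= a' <= s -> 0 <= b' <= s ->
    is_derive (u + a' *: w + b' *: v) w f (fw (u + a' *: w + b' *: v)) /\
    is_derive (u + a' *: w + b' *: v) v fw (fwv (u + a' *: w + b' *: v)).
  move=> ha' hb'; rewrite addrAC; have [hU _ _] := hs _ _ hb' ha'.
  by split; [exact: hw|exact: hwv].
have [a' [b' [ha' hb' e2]]] := second_increment s0 hs'.
have [_ _ l1] := hs _ _ ha hb; have [_ l2 _] := hs _ _ hb' ha'.
have : fvw (u + a *: v + b *: w) * s * s = fwv (u + b' *: v + a' *: w) * s * s.
  rewrite -e1 [in RHS]addrAC -e2 [u + s *: w + s *: v]addrAC; lra.
move/(mulIf (lt0r_neq0 s0))/(mulIf (lt0r_neq0 s0)); lra.
Unshelve. all: by end_near. Qed.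

Lemma derive0_ball_cst p q (M : V -> 'M[R]_(p, q)) u (e : R) :
  (forall x v, ball u e x -> is_derive x v M 0) ->
  forall x, ball u e x -> M x = M u.
Proof.
move=> h x ux; apply/matrixP => i j.
have [|a a1] := @MVT_line (fun y => M y i j) (fun=> 0) u (x - u) 1 ltr01.
  move=> a /andP[a0 a1].
  have : is_derive (u + a *: (x - u)) (x - u) M 0.
    apply: h; move: ux; rewrite -!ball_normE /ball_/= opprD addNKr normrN.
    rewrite distrC normrZ ger0_norm//; apply: le_lt_trans.
    by rewrite ler_piMl.
  by move=> /is_derive_mxP /(_ i j); rewrite mxE.
by rewrite mul0r scale1r subrKC => /eqP; rewrite subr_eq0 => /eqP.
Qed.

End mean_value.

(** * Local geometry of an immersion *)

Section smooth_maps.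
Context {R : realType} {V W : normedModType R}.

Lemma smooth_on_cst (U : set V) (a : W) : smooth_on U (fun=> a).
Proof.
move=> k; elim: k a => [|k IH] a /=.
  by move=> u _; exact: cst_continuous.
split=> [u _|v]; first exact: differentiable_cst.
by have -> : (fun u : V => 'D_v (fun=> a) u) = (fun=> 0 : W)
  by apply/funext => u; rewrite derive_cst.
Qed.

Lemma smooth_on_derivative (U : set V) (f : V -> W) v :
  smooth_on U f -> smooth_on U ('D_v f).
Proof. by move=> sf k; have [_ h] := sf k.+1; exact: h. Qed.

Lemma smooth_on_differentiable (U : set V) (f : V -> W) u :
  smooth_on U f -> U u -> differentiable f u.
Proof. by move=> sf; have [+ _] := sf 1%N; apply. Qed.

Lemma smooth_on_is_derive (U : set V) (f : V -> W) u v :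
  smooth_on U f -> U u -> is_derive u v f ('D_v f u).
Proof.
by move=> sf Uu; apply/derivableP/diff_derivable/(smooth_on_differentiable sf).
Qed.

Lemma smooth_on_continuous (U : set V) (f : V -> W) u :
  smooth_on U f -> U u -> {for u, continuous f}.
Proof. by move=> sf; exact: (sf 0%N). Qed.

End smooth_maps.

Lemma row_entry (R : Type) (p q : nat) (A : 'M[R]_(p, q)) i j :
  row i A 0 j = A i j.
Proof. by rewrite mxE. Qed.

Lemma row_mul_entry (R : pzSemiRingType) (p q r : nat) (A : 'M[R]_(p, q))
    (B : 'M[R]_(q, r)) i j :
  (row i A *m B) 0 j = (A *m B) i j.
Proof. by rewrite -row_mul row_entry. Qed.

(* Row j is the second derivative of phi along v and the j-th basis vector.
   Locked, as unification would otherwise unfold the limits inside. *)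
HB.lock Definition hessian (R : realType) (n k : nat)
    (phi : 'rV[R]_n -> 'rV[R]_k) (v u : 'rV[R]_n) : 'M[R]_(n, k) :=
  \matrix_(j, l) 'D_v ('D_(delta_mx 0 j) phi) u 0 l.
Canonical hessian_unlockable := Unlockable hessian.unlock.

Section local_geometry.
Context {R : realType} {n k : nat} (phi : 'rV[R]_n -> 'rV[R]_k).
Context (U : set 'rV[R]_n).
Hypothesis openU : open U.
Hypothesis smooth_phi : smooth_on U phi.
Implicit Types (u v : 'rV[R]_n).

Lemma near_domain u : U u -> \near u, U u.
Proof. by move=> Uu; apply: open_nbhs_nbhs; split. Qed.

Lemma jacobianE v u : U u -> v *m 'J phi u = 'D_v phi u.
Proof.
move=> Uu; rewrite deriveEjacobian//.
exact: smooth_on_differentiable smooth_phi Uu.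
Qed.

Lemma jacobian_entry u j l : U u ->
  'J phi u j l = 'D_(delta_mx 0 j) phi u 0 l.
Proof. by move=> Uu; rewrite -jacobianE// -rowE [RHS]mxE. Qed.

Local Notation hessian := (hessian phi).

Lemma hessianE v u j l :
  hessian v u j l = 'D_v ('D_(delta_mx 0 j) phi) u 0 l.
Proof. by rewrite unlock mxE. Qed.

Lemma row_hessian v u j : row j (hessian v u) = 'D_v ('D_(delta_mx 0 j) phi) u.
Proof. by apply/rowP => l; rewrite row_entry hessianE. Qed.

Lemma is_derive_jacobian v u : U u ->
  is_derive u v (fun x => 'J phi x) (hessian v u).
Proof.
move=> Uu; apply/is_derive_mxP => j l; rewrite hessianE.
apply: (@near_eq_is_derive _ _ _ (fun x => 'D_(delta_mx 0 j) phi x 0 l)).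
  by near=> x; rewrite jacobian_entry//; near: x; exact: near_domain.
apply: (is_derive_mxP _ _ _ _).1.
exact: (smooth_on_is_derive _ (smooth_on_derivative _ smooth_phi)).
Unshelve. all: by end_near. Qed.

Lemma derive_derive_comm v w u : U u ->
  'D_v ('D_w phi) u = 'D_w ('D_v phi) u.
Proof.
move=> Uu; apply/rowP => l.
have s1 a := smooth_on_derivative a smooth_phi.
have s2 a b := smooth_on_derivative b (s1 a).
have c2 a b : {for u, continuous (fun x => 'D_b ('D_a phi) x 0 l)}.
  apply: (@continuous_comp _ _ _ ('D_b ('D_a phi)) (fun M : 'rV[R]_k => M 0 l)).
    exact: (smooth_on_continuous (s2 a b)).
  exact: coord_continuous.
apply: (@derive_comm _ _ (fun x => phi x 0 l) (fun x => 'D_w phi x 0 l)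
  (fun x => 'D_v phi x 0 l) (fun x => 'D_v ('D_w phi) x 0 l)
  (fun x => 'D_w ('D_v phi) x 0 l) u w v U) => //.
- exact: near_domain.
- by move=> x Ux; apply: (is_derive_mxP _ _ _ _).1;
    exact: (smooth_on_is_derive _ smooth_phi).
- by move=> x Ux; apply: (is_derive_mxP _ _ _ _).1;
    exact: (smooth_on_is_derive _ smooth_phi).
- by move=> x Ux; apply: (is_derive_mxP _ _ _ _).1;
    exact: (smooth_on_is_derive _ (s1 _)).
- by move=> x Ux; apply: (is_derive_mxP _ _ _ _).1;
    exact: (smooth_on_is_derive _ (s1 _)).
Qed.

Lemma hessian_sym u i j : U u ->
  row j (hessian (delta_mx 0 i) u) = row i (hessian (delta_mx 0 j) u).
Proof.
by move=> Uu; rewrite 2!row_hessian; exact: derive_derive_comm.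
Qed.

Lemma dmetricE u i j l : U u ->
  dmetric phi u i j l =
  (hessian (delta_mx 0 i) u *m ('J phi u)^T) j l +
  (hessian (delta_mx 0 i) u *m ('J phi u)^T) l j.
Proof.
move=> Uu; have dJ := is_derive_jacobian (delta_mx 0 i) Uu.
have /is_derive_mxP/(_ j l) := is_derive_mulmx dJ (is_derive_trmx dJ).
rewrite mxE => -[_ e]; rewrite [LHS]e; congr (_ + _).
by rewrite -{1}(trmxK ('J phi u)) -trmx_mul [LHS]mxE.
Qed.

(* By symmetry of the second derivatives, the Koszul formula gives
   nabla_i e_j as the tangential part of the second derivative. *)
Lemma levi_civita_hessian u i j : U u ->
  levi_civita phi (delta_mx 0 i) (fun=> delta_mx 0 j) u =
  row j (hessian (delta_mx 0 i) u) *m ('J phi u)^T *m invmx (metric phi u).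
Proof.
move=> Uu; rewrite /levi_civita derive_cst add0r; apply/rowP => l.
pose T i := hessian (delta_mx 0 i) u *m ('J phi u)^T.
(* [T a b c] is the inner product of the second derivative along a, b with the c-th coordinate
   vector. *)
have Tsym a b c : T a b c = T b a c.
  have e : (row b (hessian (delta_mx 0 a) u) *m ('J phi u)^T) 0 c =
    (row a (hessian (delta_mx 0 b) u) *m ('J phi u)^T) 0 c.
    by congr ((_ *m _) 0 c); exact: hessian_sym.
  by apply: etrans (etrans (esym _) e) _; exact: row_mul_entry.
rewrite [LHS]mxE (bigD1 i)//= [X in _ + X]big1 => [|a ai]; last first.
  by rewrite big1 // => b _; rewrite !mxE (negPf ai) mulr0 mul0r.
rewrite addr0 (bigD1 j)//= [X in _ + X]big1 => [|b bj]; last first.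
  by rewrite [X in _ * X]mxE (negPf bj) andbF mulr0.
rewrite addr0 ![delta_mx _ _ _ _]mxE !eqxx !mulr1 /christoffel.
rewrite -row_mul -/(T i) -row_mul row_entry.
rewrite [RHS]mxE.
rewrite big_distrr/=; apply: eq_bigr => s _.
rewrite 3?dmetricE//.
rewrite -/(T i) -/(T j) -/(T s).
(* After these exchanges the bracket of the Christoffel symbol is twice [T i j s]. *)
rewrite (Tsym j i) (Tsym s i j) (Tsym s j i).
have -> : invmx (metric phi u) l s = invmx (metric phi u) s l.
  rewrite -[in LHS](trmxK (metric phi u)) -trmx_inv [LHS]mxE.
  by rewrite /metric trmx_mul trmxK.
lra.
Qed.

End local_geometry.

(** * Consequences of parallel F in one chart *)

Section parallel_slant.
Context {R : realType} {n m : nat} (phi : 'rV[R]_n -> 'rV[R]_(m + m)).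
Context (U : set 'rV[R]_n).
Hypothesis openU : open U.
Hypothesis smooth_phi : smooth_on U phi.
Hypothesis free_phi : forall u, U u -> row_free ('J phi u).
Hypothesis tanJ : forall u, U u -> nowhere_totally_real ('J phi u).
Hypothesis norJ : forall u, U u -> nowhere_complex ('J phi u).
Hypothesis parallel : forall u v (Y : 'rV[R]_n -> 'rV[R]_n), U u ->
  smooth_on U Y -> nablaF phi v Y u = 0.
Implicit Types (u v : 'rV[R]_n).

Local Notation J := (@Jmx R m).
Local Notation T u := ('J phi u).
Local Notation H := (hessian phi).

Lemma nor_partE u w : U u -> nor_part (T u) w = w *m (1%:M - oproj (T u)).
Proof.
move=> Uu; rewrite /nor_part /tan_part tan_part_oproj ?free_phi//.
by rewrite mulmxBr mulmx1.
Qed.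

Lemma derivable_Pmx u v : U u -> derivable (fun x => Pmx (T x)) u v.
Proof.
move=> Uu; have dT := is_derive_jacobian openU smooth_phi v Uu.
have /derivableP dI : derivable
    (fun x => (T x)^T *m invmx (T x *m (T x)^T)) u v.
  apply: derivable_tr_gram_inv; last by case: dT.
  by near=> x; apply: free_phi; near: x; exact: near_domain.
have -> : (fun x => Pmx (T x)) =
    (fun x => T x *m J *m ((T x)^T *m invmx (T x *m (T x)^T))).
  by apply/funext => x; rewrite unlock !mulmxA.
by have [] := is_derive_mulmx (is_derive_mulmxr J dT) dI.
Unshelve. all: by end_near. Qed.

(** Row j is (nabla_v F) e_j = 0 for the constant field e_j. As F e_j = J e_j - P e_j, the
    derivative of P contributes only a tangent vector, which the normal projection kills. *)
Lemma nablaF_hessian u v : U u ->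
  (H v u *m J - Pmx (T u) *m H v u -
   (\matrix_j levi_civita phi v (fun=> delta_mx 0 j) u) *m T u *m J) *m
  (1%:M - oproj (T u)) = 0.
Proof.
move=> Uu; apply/row_matrixP => j; rewrite row0.
have dT := is_derive_jacobian openU smooth_phi v Uu.
have /derivableP dP := derivable_Pmx (v := v) Uu.
pose e : 'rV[R]_n := delta_mx 0 j.
have dF : is_derive u v (Fop phi (fun=> e))
    (e *m (H v u *m J -
      ('D_v (fun x => Pmx (T x)) u *m T u + Pmx (T u) *m H v u))).
  have d := is_deriveB (is_derive_mulmxr J dT) (is_derive_mulmx dP dT).
  apply: near_eq_is_derive (is_derive_mulmxl e d).
  near=> x; have Ux : U x by near: x; exact: near_domain.
  rewrite /Fop nor_partE// Jop_mulmx /push.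
  rewrite [X in e *m X](_ : _ = T x *m J - Pmx (T x) *m T x)// PmxE.
  by rewrite !mulmxBr !mulmx1 !mulmxA.
have := parallel v Uu (smooth_on_cst U e).
rewrite /nablaF /normal_connection nor_partE//.
have [_ ->] := dF.
rewrite /Fop nor_partE// Jop_mulmx /push -mulmxBl.
set C := \matrix_j _; have <- : e *m C = levi_civita phi v (fun=> e) u.
  by rewrite -rowE rowK.
set P' := 'D_v _ u; set Q := 1%:M - _ => h.
have TQ : T u *m Q = 0.
  by rewrite /Q mulmxBr mulmx1 mulmx_oproj ?subrr ?free_phi.
rewrite rowE; apply: etrans h; rewrite mulmxA.
(* The vanishing normal part of the tangent term e P' T is put back to match the derivative of F. *)
rewrite -[LHS]subr0 -(mulmx0 _ (e *m P')) -TQ mulmxA -mulmxBl; congr (_ *m Q).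
rewrite !mulmxBr mulmxDr opprD !mulmxA.
by rewrite [in RHS]addrA [X in _ = X - _]addrAC [RHS]addrAC.
Unshelve. all: by end_near. Qed.

Lemma hessian_sub_frame u v : U u -> (H v u <= complex_frame (T u))%MS.
Proof.
move=> Uu.
exact: (parallel_sub_frame (free_phi Uu) (norJ Uu) (nablaF_hessian v Uu)).
Qed.

(** The frame (T, TJ) has derivative (H, HJ), whose rows lie in the J-invariant space T + JT. *)
Lemma is_derive_oproj_frame u v : U u ->
  is_derive u v (fun x => oproj (complex_frame (T x))) 0.
Proof.
move=> Uu; have dT := is_derive_jacobian openU smooth_phi v Uu.
have dE := is_derive_col_mx dT (is_derive_mulmxr J dT).
apply: (is_derive_oproj0 _ dE).
  near=> x; have Ux : U x by near: x; exact: near_domain.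
  by apply: frame_free; [exact: free_phi|exact: norJ].
rewrite col_mx_sub hessian_sub_frame//=.
exact: submx_trans (submxMr _ (hessian_sub_frame _ Uu)) (frameJ _).
Unshelve. all: by end_near. Qed.

Lemma frame_locally_constant u (e : R) : U u -> ball u e `<=` U ->
  forall x, ball u e x ->
    oproj (complex_frame (T x)) = oproj (complex_frame (T u)) /\
    (phi x - phi u) *m (1%:M - oproj (complex_frame (T u))) = 0.
Proof.
move=> Uu eU; pose W := oproj (complex_frame (T u)).
have cst x : ball u e x -> oproj (complex_frame (T x)) = W.
  move: x.
  apply: (@derive0_ball_cst _ _ _ _ (fun x => oproj (complex_frame (T x)))).
  by move=> x v /eU Ux; exact: is_derive_oproj_frame.
move=> x ux; split; first exact: cst.
change ((phi x - phi u) *m (1%:M - W) = 0).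
apply/eqP; rewrite mulmxBl subr_eq0; apply/eqP.
move: x ux; apply: (@derive0_ball_cst _ _ _ _ (fun x => phi x *m (1%:M - W))).
move=> x v ux; have Ux := eU _ ux.
have := is_derive_mulmxr (1%:M - W) (smooth_on_is_derive v smooth_phi Ux).
rewrite -(jacobianE smooth_phi v Ux) -mulmxA.
have fE : row_free (complex_frame (T x)).
  by apply: frame_free; [exact: free_phi|exact: norJ].
(* The tangent space at x lies in the space spanned at x, which is the one at u by [cst]. *)
have -> : T x *m (1%:M - W) = 0.
  by apply/eqP; rewrite -(cst x ux) -oproj_sub// frame_subl.
by rewrite mulmx0.
Qed.

(** A normal xi annihilates the Levi-Civita term of the second fundamental form, so only second
    derivatives of phi remain. *)
Lemma weingartenE u (xi : 'rV[R]_(m + m)) : U u -> T u *m xi^T = 0 ->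
  weingarten phi u xi =
  (\matrix_(i, j) (H (delta_mx 0 i) u *m xi^T) j 0) *m invmx (T u *m (T u)^T).
Proof.
move=> Uu Txi; rewrite /weingarten /metric; congr (_ *m _).
apply/matrixP => i j; rewrite [LHS]mxE [RHS]mxE /dot /second_ff.
rewrite mulmxBl /push -mulmxA Txi mulmx0 subr0.
rewrite -[RHS]row_mul_entry row_hessian; congr ((_ *m _) 0 0).
apply: near_eq_derive; near=> x; rewrite (jacobianE smooth_phi)//.
by near: x; exact: near_domain.
Unshelve. all: by end_near. Qed.

Lemma weingarten_mup u (xi : 'rV[R]_(m + m)) (a : R) :
  U u -> xi *m (T u)^T = 0 ->
  mup a (char_poly (weingarten phi u xi)) =
  mup (- a) (char_poly (weingarten phi u xi)).
Proof.
move=> Uu xiT; have Txi : T u *m xi^T = 0.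
  by rewrite -[T u]trmxK -trmx_mul xiT trmx0.
have Hsym i j :
    (H (delta_mx 0 i) u *m xi^T) j 0 = (H (delta_mx 0 j) u *m xi^T) i 0.
  by rewrite -row_mul_entry (hessian_sym openU smooth_phi i j Uu) row_mul_entry.
pose S := \matrix_(i, j) (H (delta_mx 0 i) u *m xi^T) j 0.
have -> : weingarten phi u xi = S *m invmx (T u *m (T u)^T).
  exact: weingartenE.
apply: (anticomm_mup (P := Pmx (T u))).
  by apply: Pmx_unit; [exact: tanJ].
apply: Pmx_anticomm.
  by apply/matrixP => i j; rewrite [LHS]mxE [LHS]mxE [RHS]mxE Hsym.
set Q := 1%:M - oproj (T u).
(* <h(X_i, P X_j), xi> = <J h(X_i, X_j), xi>, which is symmetric in i and j. *)
have key i j : (S *m (Pmx (T u))^T) i j =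
    (H (delta_mx 0 i) u *m Q *m J *m xi^T) j 0.
  have : Pmx (T u) *m H (delta_mx 0 i) u *m xi^T =
      H (delta_mx 0 i) u *m Q *m J *m xi^T.
    have := congr1 (mulmx^~ xi^T) (nablaF_hessian (delta_mx 0 i) Uu).
    set C := \matrix_j _; rewrite mul0mx -/Q -(mulmxA _ Q).
    (* [C] holds the tangential components of H, so H - C T = H Q is the second fundamental form;
       paired with xi, parallelism of F becomes P H xi^T = H Q J xi^T. *)
    have -> : C = H (delta_mx 0 i) u *m (T u)^T *m invmx (metric phi u).
      apply/row_matrixP => l; rewrite rowK (levi_civita_hessian openU)//.
      by rewrite !row_mul.
    have -> : Q *m xi^T = xi^T.
      rewrite /Q mulmxBl mul1mx oprojE -(mulmxA _ (T u) xi^T) Txi.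
      by rewrite mulmx0 subr0.
    have -> : Q = 1%:M - (T u)^T *m invmx (metric phi u) *m T u.
      by rewrite /Q oprojE.
    rewrite !mulmxBr !mulmxBl mulmx1 !mulmxA => /eqP.
    by rewrite addrAC subr_eq0 => /eqP.
  move=> <-; rewrite -mulmxA [LHS]mxE [RHS]mxE; apply: eq_bigr => l _.
  by rewrite [in LHS]mxE [X in _ * X]mxE mulrC.
apply/matrixP => i j; rewrite [LHS]mxE !key -2!(mulmxA _ Q) -2!(mulmxA (H _ _)).
by rewrite -row_mul_entry (hessian_sym openU smooth_phi j i Uu) row_mul_entry.
Qed.

End parallel_slant.

(** * Slant immersions of a manifold *)

Section slant_angle.
Context {R : realType} {n m : nat} (B : 'M[R]_(n, m + m)) (theta : R).
Hypothesis freeB : row_free B.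
Hypothesis slantB : forall X : 'rV[R]_(m + m), (X <= B)%MS -> X != 0 ->
  angle (Jop X) B = theta.

(** A nonzero X with PX = 0 would make the angle acos 0. *)
Lemma slant_nowhere_totally_real : theta != pi / 2 -> nowhere_totally_real B.
Proof.
move=> th v vJ; apply/eqP; rewrite -(mulmx_free_eq0 v freeB).
apply: contraNT th => v0; rewrite -(slantB (submxMl v B) v0).
rewrite /angle /tan_part tan_part_oproj// Jop_mulmx vJ.
by rewrite /enorm /dot mul0mx mxE sqrtr0 mul0r acos0.
Qed.

(** A nonzero X with FX = 0 would have PX = JX, of nonzero norm since J is invertible, and the angle
    would be acos 1. *)
Lemma slant_nowhere_complex : theta != 0 -> nowhere_complex B.
Proof.
move=> th v; rewrite mulmxBr mulmx1 => /eqP; rewrite subr_eq0 => /eqP vJ.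
apply/eqP; rewrite -(mulmx_free_eq0 v freeB).
apply: contraNT th => v0; rewrite -(slantB (submxMl v B) v0).
rewrite /angle /tan_part tan_part_oproj// Jop_mulmx -vJ divff ?acos1//.
rewrite /enorm sqrtr_eq0 -ltNge lt_neqAle eq_sym; apply/andP; split.
  apply: contraNN v0 => /eqP d0.
  have : v *m B *m Jmx = 0.
    apply: mulmx_tr_eq0; apply/matrixP => i j; rewrite !ord1 [RHS]mxE.
    exact: d0.
  move=> /(congr1 (mulmx^~ Jmx)); rewrite -mulmxA Jmx_sqr mul0mx mulmxN mulmx1.
  by move=> /eqP; rewrite oppr_eq0.
rewrite /dot mxE sumr_ge0// => i _; rewrite [X in _ * X]mxE -expr2.
exact: sqr_ge0.
Qed.

End slant_angle.

(** * From charts to the whole manifold, by connectedness *)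

Section locally_constant_span.
Context {R : realType} {n k : nat} (N : manifold R n) (f : N -> 'rV[R]_k).
Hypothesis smooth_f :
  forall c, atlas c -> smooth_on (chart_cod c) (f \o param c).
Variable W : chart R n N -> 'rV[R]_n -> 'M[R]_k.
Hypothesis W_locally_constant : forall c u, atlas c -> chart_cod c u ->
  exists2 e : R, 0 < e & forall x, ball u e x ->
    [/\ chart_cod c x, W c x = W c u &
      (f (param c x) - f (param c u)) *m (1%:M - W c u) = 0].
(** This compares the subspaces of two charts without differentiating a change of coordinates. *)
Hypothesis W_tangent : forall c u c' u', atlas c -> chart_cod c u ->
  atlas c' -> chart_cod c' u' ->
  'J (f \o param c) u *m (1%:M - W c' u') = 0 -> W c u = W c' u'.

Lemma near_chart (c : chart R n N) p (A : set 'rV[R]_n) : chart_dom c p ->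
  nbhs (Defs.coord c p) A -> \near p, chart_dom c p /\ A (Defs.coord c p).
Proof.
move=> cp nA; near=> q; split; near: q.
  by apply: open_nbhs_nbhs; split; [exact: chart_dom_open|].
exact: (Defs.coord_continuous cp nA).
Unshelve. all: by end_near. Qed.

Lemma jacobian_ker (c : chart R n N) u (y : 'rV[R]_k) (Q : 'M[R]_k) : atlas c ->
  chart_cod c u -> (\forall p \near param c u, (f p - y) *m Q = 0) ->
  'J (f \o param c) u *m Q = 0.
Proof.
move=> ac cu fQ; apply/row_matrixP => i; rewrite row0 rowE mulmxA.
rewrite (jacobianE (smooth_f ac))//.
have [_ <-] := is_derive_mulmxr Q
  (smooth_on_is_derive (delta_mx 0 i) (smooth_f ac) cu).
rewrite -[RHS](derive_cst (y *m Q) u (delta_mx 0 i)); apply: near_eq_derive.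
have : \forall x \near u, (f (param c x) - y) *m Q = 0.
  exact: (param_continuous cu fQ).
apply: filterS => x.
by rewrite /= mulmxBl => /eqP; rewrite subr_eq0 => /eqP.
Qed.

(* The points near which f takes its values in the affine subspace form a
   clopen set: at a limit point q the subspaces at nearby points agree, and
   contain the tangent space of a point where they are W0. *)
Lemma sub_affine_span (c0 : chart R n N) p0 : atlas c0 -> chart_dom c0 p0 ->
  forall p, (f p - f p0) *m (1%:M - W c0 (Defs.coord c0 p0)) = 0.
Proof.
move=> ac0 cp0 p; have cu0 := coord_cod cp0.
set W0 := W c0 _; pose g q := (f q - f p0) *m (1%:M - W0).
pose S := [set q : N | \near q, g q = 0].
suff : S p by exact: nbhs_singleton.
suff -> : S = setT by [].
apply: (manifold_connected (m := N)).
- exists p0; have [e e0 he] := W_locally_constant ac0 cu0.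
  have := near_chart cp0 (nbhsx_ballx (Defs.coord c0 p0) e e0).
  rewrite /S /=; apply: filterS => q [cq uq].
  by have [_ _] := he _ uq; rewrite !coordK.
- exists S; last by rewrite setTI.
  by rewrite openE => q Sq; rewrite /interior; move/nbhs_interior: Sq.
exists S; last by rewrite setTI.
move=> q Sq; have [c ac cq] := atlas_cover q; have cu := coord_cod cq.
have [e e0 he] := W_locally_constant ac cu.
have nq := near_chart cq (nbhsx_ballx (Defs.coord c q) e e0).
have [q1 [Sq1 [cq1 uq1]]] := Sq _ nq.
have [cu1 W1 f1] := he _ uq1.
(* Near [q1] the values of f stay in the affine subspace, so the tangent space at [q1] lies in that
   of [W0]. *)
have Wq : W c (Defs.coord c q) = W0.
  rewrite -W1; apply: W_tangent => //; apply: (jacobian_ker (y := f p0)) => //.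
  by rewrite coordK.
have := nq; rewrite /S /=; apply: filterS => q2 [cq2 uq2].
have [_ _ f2] := he _ uq2.
have := nbhs_singleton Sq1; rewrite /g => g1.
(* The first two differences are controlled by the chart around [q], the last one by [q1] being in
   [S]; all are killed by 1 - W0. *)
have -> : f q2 - f p0 = (f q2 - f q) - (f q1 - f q) + (f q1 - f p0).
  by rewrite opprB !subrKA.
move: f1 f2; rewrite !coordK// Wq => f1 f2.
by rewrite mulmxDl mulmxBl f1 f2 g1 subr0 addr0.
Qed.

End locally_constant_span.

Theorem theorem3p10 (R : realType) (n m : nat) (N : manifold R n)
    (f : N -> 'rV[R]_(m + m)) (f_immersion : immersion f)
    (f_slant : proper_slant f) (f_parallel : parallel_F f) :
  exists (a : 'rV[R]_(m + m)) (V : 'M[complex R]_m),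
    [/\ \rank V = n, contained_in f a V & austere_in f V].
Proof.
have [theta [slant theta0 theta2]] := f_slant.
have smoothc c : atlas c -> smooth_on (chart_cod c) (f \o param c).
  by move=> /f_immersion[].
have freec c : atlas c ->
    forall u, chart_cod c u -> row_free ('J (f \o param c) u).
  by move=> /f_immersion[].
have tanc c : atlas c ->
    forall u, chart_cod c u -> nowhere_totally_real ('J (f \o param c) u).
  move=> ac u cu; apply: (slant_nowhere_totally_real (theta := theta)) => //.
    exact: freec.
  by move=> X; exact: slant.
have norc c : atlas c ->
    forall u, chart_cod c u -> nowhere_complex ('J (f \o param c) u).
  move=> ac u cu; apply: (slant_nowhere_complex (theta := theta)) => //.
    exact: freec.
  by move=> X; exact: slant.
have parc c : atlas c -> forall u v (Y : 'rV[R]_n -> 'rV[R]_n),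
    chart_cod c u -> smooth_on (chart_cod c) Y ->
    nablaF (f \o param c) v Y u = 0.
  by move=> ac u v Y cu; exact: f_parallel.
have fE c u : atlas c -> chart_cod c u ->
    row_free (complex_frame ('J (f \o param c) u)).
  by move=> ac cu; apply: frame_free; [exact: freec|exact: norc].
pose W (c : chart R n N) u := oproj (complex_frame ('J (f \o param c) u)).
have W_loc c u : atlas c -> chart_cod c u -> exists2 e : R, 0 < e &
    forall x, ball u e x -> [/\ chart_cod c x, W c x = W c u &
      (f (param c x) - f (param c u)) *m (1%:M - W c u) = 0].
  move=> ac cu.
  have /nbhs_ballP[e /= e0 eU] : nbhs u (chart_cod c).
    by apply: open_nbhs_nbhs; split; [exact: chart_cod_open|].
  exists e; first exact: e0.
  move=> x ux.
  have [W1 f1] := frame_locally_constant (@chart_cod_open _ _ _ c)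
    (smoothc c ac) (freec c ac) (norc c ac) (parc c ac) cu eU ux.
  exact: And3 (eU _ ux) W1 f1.
(* The space at u' is J-invariant, so containing T it contains T + JT; both have real dimension 2n
   and so coincide. *)
have W_tan c u c' u' : atlas c -> chart_cod c u -> atlas c' ->
    chart_cod c' u' ->
    'J (f \o param c) u *m (1%:M - W c' u') = 0 -> W c u = W c' u'.
  move=> ac cu ac' cu' TW; apply: oproj_eq; [exact: fE|exact: fE|].
  have fEu := fE _ _ ac cu; have fEu' := fE _ _ ac' cu'.
  have TE : ('J (f \o param c) u <=
      complex_frame ('J (f \o param c') u'))%MS.
    by rewrite (oproj_sub fEu'); apply/eqP.
  have EE : (complex_frame ('J (f \o param c) u) <=
      complex_frame ('J (f \o param c') u'))%MS.
    rewrite [X in (X <= _)%MS]/complex_frame col_mx_sub TE /=.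
    exact: submx_trans (submxMr _ TE) (frameJ _).
  exact: row_free_submx_eq EE.
have [p0 _] := manifold_nonempty N.
have [c0 ac0 cp0] := atlas_cover p0.
have fW := sub_affine_span smoothc W_loc W_tan ac0 cp0.
have fE0 := fE _ _ ac0 (coord_cod cp0).
(* The complex span of one tangent space; the brackets give a square matrix with the row space of
   the n by m frame. *)
exists (f p0), <<complex_mx ('J (f \o param c0) (Defs.coord c0 p0))>>%MS.
split.
- by rewrite mxrank_gen; apply/eqP; exact: complex_mx_free.
- move=> p; rewrite to_complexE genmxE complex_mx_sub.
  by rewrite -/(complex_frame _) (oproj_sub fE0); apply/eqP; exact: fW.
- move=> c u xi ac cu _ xiT a.
  exact: (weingarten_mup (@chart_cod_open _ _ _ c) (smoothc c ac) (freec c ac)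
    (tanc c ac) (parc c ac) a cu xiT).
Qed.
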